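(* Let $G$ be a non-archimedean Polish group that admits a two-sided invariant compatible metric, and let $X$ be a Polish space with a continuous action of $G$ such that $E^X_G$ is essentially countable. Then there is a sequence $\{N_n\}_{n\in\mathbb{N}}$ of open normal subgroups of $G$, Polish spaces $X_n$, and continuous actions of the (countable discrete) groups $H_n=G/N_n$ on $X_n$ such that $$E^X_G\le_B\bigoplus_{n\in\mathbb{N}}E^{X_n}_{H_n},$$ where $\bigoplus_n E^{X_n}_{H_n}$ denotes the equivalence relation on the disjoint union $\bigsqcup_n X_n$ whose restriction to each $X_n$ is $E^{X_n}_{H_n}$ and which relates no points of distinct $X_n$'s.
   Context: A Polish group is non-archimedean if it has a neighbourhood basis of the identity consisting of open subgroups. $E^X_G=\{(x,y):\exists g\in G\ g\cdot x=y\}$. $E\le_B F$ means there is a Borel map $\psi$ with $(x,y)\in E\iff(\psi(x),\psi(y))\in F$. $E$ is essentially countable if $E\le_B F$ and $F\le_B E$ for some Borel equivalence relation $F$ on a Polish space all of whose classes are countable. *)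

(* Defs.v *)
From Stdlib Require Import Reals.
Open Scope R_scope.
Set Implicit Arguments.

(** A topology on a type is given by its family of open sets. *)
Definition topology (T : Type) := (T -> Prop) -> Prop.

Definition is_metric {T : Type} (d : T -> T -> R) : Prop :=
  (forall x y, 0 <= d x y) /\ (forall x y, d x y = 0 <-> x = y) /\
  (forall x y, d x y = d y x) /\ (forall x y z, d x z <= d x y + d y z).

Definition metric_open {T : Type} (d : T -> T -> R) (U : T -> Prop) : Prop :=
  forall x, U x -> exists eps, 0 < eps /\ forall y, d x y < eps -> U y.

Definition compatible {T : Type} (op : topology T) (d : T -> T -> R) : Prop :=
  is_metric d /\ forall U, op U <-> metric_open d U.

Definition cauchy {T : Type} (d : T -> T -> R) (s : nat -> T) : Prop :=
  forall eps, 0 < eps -> exists N, forall m n, (N <= m)%nat -> (N <= n)%nat ->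
    d (s m) (s n) < eps.

Definition converges_to {T : Type} (d : T -> T -> R) (s : nat -> T) (x : T) : Prop :=
  forall eps, 0 < eps -> exists N, forall n, (N <= n)%nat -> d (s n) x < eps.

Definition complete {T : Type} (d : T -> T -> R) : Prop :=
  forall s, cauchy d s -> exists x, converges_to d s x.

Definition separable {T : Type} (d : T -> T -> R) : Prop :=
  exists s : nat -> T, forall x eps, 0 < eps -> exists n, d x (s n) < eps.

Definition polish {T : Type} (op : topology T) : Prop :=
  exists d, compatible op d /\ complete d /\ separable d.

Definition continuous {A B : Type} (oA : topology A) (oB : topology B) (f : A -> B) : Prop :=
  forall V, oB V -> oA (fun x => V (f x)).

Definition prod_open {A B : Type} (oA : topology A) (oB : topology B) : topology (A * B) :=
  fun U => forall p, U p -> exists V W, oA V /\ oB W /\ V (fst p) /\ W (snd p) /\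
     forall a b, V a -> W b -> U (a, b).

Definition sum_open {X : nat -> Type} (oX : forall n, topology (X n)) : topology {n : nat & X n} :=
  fun U => forall n, oX n (fun x => U (existT X n x)).

Inductive borel {T : Type} (op : topology T) : (T -> Prop) -> Prop :=
| borel_open : forall U, op U -> borel op U
| borel_compl : forall U, borel op U -> borel op (fun x => ~ U x)
| borel_cunion : forall A : nat -> T -> Prop, (forall n, borel op (A n)) ->
    borel op (fun x => exists n, A n x)
| borel_ext : forall U V, borel op U -> (forall x, U x <-> V x) -> borel op V.

Definition borel_map {A B : Type} (oA : topology A) (oB : topology B) (f : A -> B) : Prop :=
  forall V, borel oB V -> borel oA (fun x => V (f x)).

Definition borel_reducible {A B : Type} (oA : topology A) (oB : topology B)
  (E : A -> A -> Prop) (F : B -> B -> Prop) : Prop :=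
  exists f : A -> B, borel_map oA oB f /\ forall x y, E x y <-> F (f x) (f y).

Definition equivalence_rel {T : Type} (E : T -> T -> Prop) : Prop :=
  (forall x, E x x) /\ (forall x y, E x y -> E y x) /\
  (forall x y z, E x y -> E y z -> E x z).

(** Every class is countable (classes are nonempty, so: enumerated by nat) *)
Definition countable_classes {T : Type} (F : T -> T -> Prop) : Prop :=
  forall x, exists s : nat -> T, forall y, F x y -> exists n, s n = y.

Definition essentially_countable {X : Type} (oX : topology X) (E : X -> X -> Prop) : Prop :=
  exists (Y : Type) (oY : topology Y) (F : Y -> Y -> Prop),
    polish oY /\ equivalence_rel F /\
    borel (prod_open oY oY) (fun p => F (fst p) (snd p)) /\
    countable_classes F /\
    borel_reducible oX oY E F /\ borel_reducible oY oX F E.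

Record group := Group {
  gT :> Type;
  gmul : gT -> gT -> gT;
  ginv : gT -> gT;
  gone : gT;
  gmulA : forall x y z, gmul x (gmul y z) = gmul (gmul x y) z;
  gmul1l : forall x, gmul gone x = x;
  gmulVl : forall x, gmul (ginv x) x = gone }.

Arguments gmul {g}.
Arguments ginv {g}.
Arguments gone {g}.

Definition subgroup {G : group} (N : G -> Prop) : Prop :=
  N gone /\ (forall x y, N x -> N y -> N (gmul x y)) /\ (forall x, N x -> N (ginv x)).

Definition normal_subgroup {G : group} (N : G -> Prop) : Prop :=
  subgroup N /\ forall g h, N h -> N (gmul (gmul g h) (ginv g)).

(** pi : G -> H is a surjective homomorphism with kernel N, i.e. H is
    (isomorphic to) the quotient group G/N via pi *)
Definition quotient_map {G H : group} (N : G -> Prop) (pi : G -> H) : Prop :=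
  (forall x y, pi (gmul x y) = gmul (pi x) (pi y)) /\
  (forall h : H, exists g, pi g = h) /\
  (forall g, pi g = gone <-> N g).

Definition polish_group {G : group} (oG : topology G) : Prop :=
  polish oG /\
  continuous (prod_open oG oG) oG (fun p => gmul (fst p) (snd p)) /\
  continuous oG oG ginv.

Definition non_archimedean {G : group} (oG : topology G) : Prop :=
  forall U, oG U -> U gone -> exists V, oG V /\ subgroup V /\ forall x, V x -> U x.

Definition has_tsi_metric {G : group} (oG : topology G) : Prop :=
  exists d, compatible oG d /\
    forall g h k, d (gmul g h) (gmul g k) = d h k /\ d (gmul h g) (gmul k g) = d h k.

Definition is_action {G : group} {X : Type} (a : G -> X -> X) : Prop :=
  (forall x, a gone x = x) /\ (forall g h x, a (gmul g h) x = a g (a h x)).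

Definition continuous_action {G : group} (oG : topology G) {X : Type} (oX : topology X)
  (a : G -> X -> X) : Prop :=
  is_action a /\ continuous (prod_open oG oX) oX (fun p => a (fst p) (snd p)).

(** Continuous action of a discrete group: each element acts continuously
    (this is continuity of H x X -> X when H carries the discrete topology) *)
Definition discrete_continuous_action {H : group} {X : Type} (oX : topology X)
  (a : H -> X -> X) : Prop :=
  is_action a /\ forall h, continuous oX oX (a h).

Definition orbit_rel {A X : Type} (a : A -> X -> X) (x y : X) : Prop :=
  exists g, a g x = y.

Definition sum_rel {X : nat -> Type} (R : forall n, X n -> X n -> Prop)
  (p q : {n : nat & X n}) : Prop :=
  exists n (x y : X n), p = existT X n x /\ q = existT X n y /\ R n x y.

(* Main.v *)
Require Import Defs.
From Stdlib Require Import Reals Lra Lia List Cantor Classical ClassicalEpsilon.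
From Stdlib Require Import FunctionalExtensionality PropExtensionality Eqdep_dec.

(** Let [f : X -> Y] reduce the orbit relation to an equivalence relation with
    countable classes, let [V k] be countably many open sets separating the points
    of [Y], and let [N n] be open normal subgroups forming a neighbourhood basis of
    the identity. For each [x] the map [g => f (g x)] takes countably many values,
    so by Baire category it is constant on a comeager subset of some coset of some
    [N n]. Record for each coset [c] of [N n] and each [k] whether [f (g x)] is in
    [V k], respectively outside [V k], for comeagerly many [g] in [c]. This profile
    is a point of the Cantor space [2^(G/N n * (nat * bool))]; it depends on [x] in a
    Borel way, and translating [x] by [g] shifts the profile by the class of [g].
    Sending [x] to its profile for the least [n] that works is the reduction: if
    the profiles of [x] and [y] agree and [g => f (g x)] is generically constant on
    a coset, then [f (g x) = f (g y)] for a generic [g] there. *)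

(** * Baire category *)

Definition is_topology {T : Type} (op : topology T) : Prop :=
  op (fun _ => True) /\
  (forall U V, op U -> op V -> op (fun x => U x /\ V x)) /\
  (forall U, (forall x, U x -> exists V, op V /\ V x /\ forall y, V y -> U y) -> op U).

Definition dense {T : Type} (op : topology T) (D : T -> Prop) : Prop :=
  forall U x, op U -> U x -> exists y, U y /\ D y.

Definition baire {T : Type} (op : topology T) : Prop :=
  forall O : nat -> T -> Prop, (forall i, op (O i)) -> (forall i, dense op (O i)) ->
    dense op (fun x => forall i, O i x).

(** The dense open sets are taken in the whole space, not in [W]. For open [W] this is ordinary
    comeagerness in [W], because relatively dense open subsets become dense after adding the
    exterior of [W]. *)
Definition comeager_on {T : Type} (op : topology T) (W P : T -> Prop) : Prop :=
  exists O : nat -> T -> Prop, (forall i, op (O i)) /\ (forall i, dense op (O i)) /\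
    forall x, W x -> (forall i, O i x) -> P x.

(** Members are nonempty so that, in a Baire space, no set is both comeager and meager on one of
    them. *)
Definition basis {T : Type} (op : topology T) (B : nat -> T -> Prop) : Prop :=
  (forall i, op (B i)) /\ (forall i, exists x, B i x) /\
  (forall U x, op U -> U x -> exists i, B i x /\ forall y, B i y -> U y).

Lemma compatible_topology {T} (op : topology T) d : compatible op d -> is_topology op.
Proof.
  intros [_ Hop]. repeat split.
  - apply Hop. intros x _. exists 1. split; [lra | auto].
  - intros U V HU HV. apply Hop in HU; apply Hop in HV. apply Hop. intros x [Ux Vx].
    destruct (HU x Ux) as [e [He HeU]]; destruct (HV x Vx) as [e' [He' HeV]].
    exists (Rmin e e'). split; [apply Rmin_pos; auto|].
    intros y Hy. pose proof (Rmin_l e e'); pose proof (Rmin_r e e').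
    split; [apply HeU | apply HeV]; lra.
  - intros U H. apply Hop. intros x Ux. destruct (H x Ux) as [V [HV [Vx HVU]]].
    apply Hop in HV. destruct (HV x Vx) as [e [He HeV]]. exists e; auto.
Qed.

Lemma compatible_ball {T} (op : topology T) d x r :
  compatible op d -> op (fun y => d x y < r).
Proof.
  intros [[Hp [H0 [Hs Ht]]] Hop]. apply Hop. intros y Hy. exists (r - d x y).
  split; [lra|]. intros z Hz. pose proof (Ht x y z). lra.
Qed.

Lemma inv_INR_pos n : 0 < / (INR n + 1).
Proof. apply Rinv_0_lt_compat. pose proof (pos_INR n). lra. Qed.

Lemma inv_INR_small eps : 0 < eps -> exists n, / (INR n + 1) < eps.
Proof.
  intro He. destruct (archimed_cor1 eps He) as [n [Hn Hn0]]. exists n.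
  apply Rlt_trans with (/ INR n); auto.
  apply lt_0_INR in Hn0. apply Rinv_lt_contravar; [apply Rmult_lt_0_compat|]; lra.
Qed.

Lemma polish_basis {T} (op : topology T) : polish op -> exists B, basis op B.
Proof.
  intros [d [Hc [_ [s Hs]]]].
  pose proof Hc as [[Hp [H0 [Hsym Ht]]] Hop].
  exists (fun i x => d (s (fst (of_nat i))) x < / (INR (snd (of_nat i)) + 1)).
  repeat split.
  - intro i. apply compatible_ball; auto.
  - intro i. exists (s (fst (of_nat i))).
    rewrite (proj2 (H0 _ _) eq_refl). apply inv_INR_pos.
  - intros U x HU Ux. apply Hop in HU. destruct (HU x Ux) as [e [He HeU]].
    destruct (inv_INR_small (e / 2)) as [m Hm]; [lra|].
    destruct (Hs x (/ (INR m + 1))) as [k Hk]; [apply inv_INR_pos|].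
    exists (to_nat (k, m)). rewrite cancel_of_to; simpl. rewrite Hsym. split; auto.
    intros y Hy. apply HeU. pose proof (Ht x (s k) y). lra.
Qed.

(** Shrink balls inside the successive [O n], at least halving the radii. The centres form a Cauchy
    sequence, and the limit stays in every closed ball. *)
Lemma polish_baire {T} (op : topology T) : polish op -> baire op.
Proof.
  intros [d [Hc [Hcompl _]]] O HO HD W x0 HW Wx0.
  pose proof Hc as [[Hp [H0 [Hsym Ht]]] Hop].
  pose proof (compatible_topology op d Hc) as [_ [Hinter _]].
  apply Hop in HW. destruct (HW x0 Wx0) as [e [He HeW]].
  (* The premise [0 < snd p] makes the relation total on all pairs, as [choice] demands; positivity
     is recovered in [Hpos]. *)
  set (step := fun (np : nat * (T * R)) (p' : T * R) => let p := snd np in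
    0 < snd p -> 0 < snd p' /\ snd p' <= snd p / 2 /\ d (fst p) (fst p') + snd p' <= snd p /\
      forall y, d (fst p') y <= snd p' -> O (fst np) y).
  assert (Hstep : forall np, exists p', step np p').
  { intros [n [c r]]. unfold step; simpl.
    destruct (classic (0 < r)) as [Hr|Hr]; [|exists (c, r); tauto].
    destruct (HD n (fun y => d c y < r) c) as [c' [Hc' HOc']].
    { apply compatible_ball; auto. }
    { rewrite (proj2 (H0 c c) eq_refl); auto. }
    pose proof (proj1 (Hop _) (HO n) c' HOc') as [e' [He' HeO]].
    exists (c', Rmin (r / 2) (Rmin (r - d c c') (e' / 2))). simpl. intros _.
    pose proof (Rmin_l (r / 2) (Rmin (r - d c c') (e' / 2))).
    pose proof (Rmin_r (r / 2) (Rmin (r - d c c') (e' / 2))).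
    pose proof (Rmin_l (r - d c c') (e' / 2)).
    pose proof (Rmin_r (r - d c c') (e' / 2)).
    split; [repeat apply Rmin_pos; lra|]. split; [lra|]. split; [lra|].
    intros y Hy. apply HeO. lra. }
  destruct (choice _ Hstep) as [F HF].
  set (p := fix p n := match n with 0%nat => (x0, e / 2) | S n => F (n, p n) end).
  assert (Hpos : forall n, 0 < snd (p n)).
  { induction n; simpl; [lra|]. apply (HF (n, p n)); auto. }
  assert (Hnext : forall n, step (n, p n) (p (S n))) by (intro n; apply HF).
  assert (Hnest : forall k n, d (fst (p n)) (fst (p (k + n)%nat)) + snd (p (k + n)%nat) <= snd (p n)).
  { induction k; intro n.
    - simpl. rewrite (proj2 (H0 _ _) eq_refl). lra.
    - destruct (Hnext (k + n)%nat) as [_ [_ [H _]]]; [apply Hpos|].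
      specialize (IHk n). simpl in *.
      pose proof (Ht (fst (p n)) (fst (p (k + n)%nat)) (fst (F ((k + n)%nat, p (k + n)%nat)))). lra. }
  (* The radii decrease geometrically, but this harmonic bound suffices; its induction step is
     [n + 2 <= 2 * (n + 1)]. *)
  assert (Hsmall : forall n, snd (p n) <= (e / 2) * / (INR n + 1)).
  { induction n; [simpl; rewrite Rplus_0_l, Rinv_1; lra|].
    destruct (Hnext n) as [_ [H _]]; [apply Hpos|]. simpl snd in H at 2.
    rewrite S_INR. pose proof (pos_INR n).
    assert (/ (INR n + 1) / 2 <= / (INR n + 1 + 1)).
    { unfold Rdiv. rewrite <- Rinv_mult. apply Rinv_le_contravar; lra. }
    simpl fst in H; simpl snd in H.
    apply Rle_trans with (e / 2 * (/ (INR n + 1) / 2)); [simpl; lra|].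
    apply Rmult_le_compat_l; lra. }
  destruct (Hcompl (fun n => fst (p n))) as [y Hy].
  { intros eps Heps.
    destruct (inv_INR_small (eps / e)) as [N HN]; [apply Rdiv_lt_0_compat; lra|].
    assert (HN' : e * / (INR N + 1) < eps).
    { apply Rmult_lt_compat_l with (r := e) in HN; auto.
      replace (e * (eps / e)) with eps in HN by (field; lra). exact HN. }
    exists N. intros m n Hm Hn. pose proof (Hsmall N).
    pose proof (Hnest (m - N)%nat N) as A; pose proof (Hnest (n - N)%nat N) as B.
    replace (m - N + N)%nat with m in A by lia. replace (n - N + N)%nat with n in B by lia.
    pose proof (Hpos m); pose proof (Hpos n).
    pose proof (Ht (fst (p m)) (fst (p N)) (fst (p n))).
    rewrite (Hsym (fst (p m)) (fst (p N))) in *. lra. }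
  assert (Hin : forall n, d (fst (p n)) y <= snd (p n)).
  { intro n. apply Rnot_lt_le. intro Hlt.
    destruct (Hy (d (fst (p n)) y - snd (p n))) as [N HN]; [lra|].
    specialize (HN (N + n)%nat ltac:(lia)). pose proof (Hnest N n). pose proof (Hpos (N + n)%nat).
    pose proof (Ht (fst (p n)) (fst (p (N + n)%nat)) y). lra. }
  exists y. split.
  - apply HeW. pose proof (Hin 0%nat). simpl in *. lra.
  - intro n. destruct (Hnext n) as [_ [_ [_ H]]]; [apply Hpos|]. apply H, Hin.
Qed.

(** The countably many witnessing sequences are merged into one by the pairing function. The sets
    [W n] become premises under the quantifier, so they may vary with [n]. *)
Lemma comeager_on_forall {T} (op : topology T) (W P : nat -> T -> Prop) :
  (forall n, comeager_on op (W n) (P n)) ->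
  comeager_on op (fun _ => True) (fun x => forall n, W n x -> P n x).
Proof.
  intro H. destruct (choice _ H) as [O HO].
  exists (fun i => O (fst (of_nat i)) (snd (of_nat i))). split; [|split].
  - intro i. apply HO.
  - intro i. apply HO.
  - intros x _ Hx n Wx. apply (HO n); auto. intro i.
    specialize (Hx (to_nat (n, i))). rewrite cancel_of_to in Hx. exact Hx.
Qed.

Lemma comeager_on_mono {T} (op : topology T) (W W' P P' : T -> Prop) :
  comeager_on op W P -> (forall x, W' x -> W x) -> (forall x, W' x -> P x -> P' x) ->
  comeager_on op W' P'.
Proof. intros [O [HO [HD H]]] HW HP. exists O. firstorder. Qed.

Lemma comeager_on_dense_open {T} (op : topology T) (W D : T -> Prop) :
  op D -> dense op D -> comeager_on op W D.
Proof. intros HO HD. exists (fun _ => D). repeat split; auto. intros x _ H. exact (H 0%nat). Qed.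

Lemma comeager_on_all {T} (op : topology T) (W P : T -> Prop) :
  is_topology op -> (forall x, W x -> P x) -> comeager_on op W P.
Proof.
  intros [H1 _] H. exists (fun _ _ => True). repeat split; auto.
  intros _ U x _ Ux. exists x; auto.
Qed.

Lemma comeager_on_and {T} (op : topology T) (W P Q : T -> Prop) :
  comeager_on op W P -> comeager_on op W Q -> comeager_on op W (fun x => P x /\ Q x).
Proof.
  intros HP HQ.
  apply comeager_on_mono with (W := fun _ => True)
    (P := fun x => forall n : nat, W x -> if Nat.eqb n 0 then P x else Q x).
  - apply (comeager_on_forall op (fun _ => W)). intros [|n]; simpl; auto.
  - auto.
  - intros x Wx H. exact (conj (H 0%nat Wx) (H 1%nat Wx)).
Qed.

Lemma comeager_on_meets {T} (op : topology T) (W P : T -> Prop) x :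
  baire op -> op W -> W x -> comeager_on op W P -> exists y, W y /\ P y.
Proof.
  intros HB HW Wx [O [HO [HD H]]]. destruct (HB O HO HD W x HW Wx) as [y [Wy Hy]].
  exists y; auto.
Qed.

(** Comeagerness is local: the union of the basic sets on which [P] is comeager is open and dense in
    [W], and there are only countably many of them, so [P] is generic on this union. *)
Lemma comeager_on_local {T} (op : topology T) (B : nat -> T -> Prop) (W P : T -> Prop) :
  is_topology op -> basis op B -> op W ->
  (forall i, (forall x, B i x -> W x) ->
     exists j, (forall x, B j x -> B i x) /\ comeager_on op (B j) P) ->
  comeager_on op W P.
Proof.
  intros [HT1 [HT2 HT3]] [HB1 [HB2 HB3]] HW H.
  set (V := fun j x => comeager_on op (B j) P /\ B j x).
  (* The second alternative is the exterior of [W]; it makes [D] dense in the whole space. *)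
  set (D := fun x => (exists j, V j x) \/
                     exists U, op U /\ U x /\ forall y, U y -> ~ W y).
  assert (HV : comeager_on op (fun _ => True) (fun x => forall j, V j x -> P x)).
  { apply (comeager_on_forall op V (fun _ => P)). intro j.
    destruct (classic (comeager_on op (B j) P)) as [C|C].
    - apply comeager_on_mono with (1 := C); unfold V; tauto.
    - apply comeager_on_all; [repeat split; auto|]. unfold V; tauto. }
  assert (HD : comeager_on op W D).
  { apply comeager_on_dense_open.
    - apply HT3. intros x [[j [Cj Bx]] | [U [HU [Ux HUW]]]].
      + exists (B j). split; auto. split; auto. intros y By. left. exists j. split; auto.
      + exists U. split; auto. split; auto. intros y Uy. right. exists U; auto.
    - intros U x HU Ux.
      destruct (classic (exists y, U y /\ W y)) as [[y [Uy Wy]]|N].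
      + destruct (HB3 (fun z => U z /\ W z) y) as [i [_ Bi]]; auto.
        destruct (H i) as [j [Hj Cj]]; [intros; apply Bi; auto|].
        destruct (HB2 j) as [z Bz]. exists z. split; [apply Bi; auto|].
        left. exists j. split; auto.
      + exists x. split; auto. right. exists U. split; auto. split; auto.
        intros y Uy Wy. apply N. exists y; auto. }
  apply comeager_on_mono with (W := W) (P := fun x => (forall j, V j x -> P x) /\ D x).
  - apply comeager_on_and; auto. apply comeager_on_mono with (1 := HV); auto.
  - auto.
  - intros x Wx [HP [[j Vj] | [U [_ [Ux HU]]]]]; [eauto | exfalso; eapply HU; eauto].
Qed.

(* A form of the Baire property: below every nonempty open set there is a basic
   one on which a Borel set is comeager or meager. *)
Lemma borel_localize {T} (op : topology T) (B : nat -> T -> Prop) (S : T -> Prop) :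
  is_topology op -> basis op B -> borel op S -> forall i,
  exists j, (forall x, B j x -> B i x) /\
    (comeager_on op (B j) S \/ comeager_on op (B j) (fun x => ~ S x)).
Proof.
  intros HT HB HS. pose proof HT as [_ [HT2 _]]. pose proof HB as [HB1 [HB2 HB3]].
  induction HS as [S HS | S HS IH | A HA IH | S S' HS IH E]; intro i.
  - destruct (classic (exists x, B i x /\ S x)) as [[x [Bx Sx]]|N].
    + destruct (HB3 (fun y => B i y /\ S y) x) as [j [_ Hj]]; auto.
      exists j. split; [apply Hj|]. left. apply comeager_on_all; auto. apply Hj.
    + exists i. split; auto. right. apply comeager_on_all; auto.
      intros x Bx Sx. apply N. exists x; auto.
  - destruct (IH i) as [j [Hj [C|C]]]; exists j; split; auto.
    right. apply comeager_on_mono with (1 := C); auto.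
  (* If no [A n] is comeager on any basic set below [B i], then by induction and locality every
     [A n] is meager on [B i], and so is the union. *)
  - destruct (classic (exists n j, (forall x, B j x -> B i x) /\ comeager_on op (B j) (A n)))
      as [[n [j [Hj C]]]|N].
    + exists j. split; auto. left. apply comeager_on_mono with (1 := C); eauto.
    + exists i. split; auto. right.
      apply comeager_on_mono with (W := fun _ => True) (P := fun x => forall n : nat, B i x -> ~ A n x).
      * apply (comeager_on_forall op (fun _ => B i)). intro n.
        apply comeager_on_local with (B := B); auto. intros k Hk.
        destruct (IH n k) as [j [Hj [C|C]]]; [|eauto].
        exfalso. apply N. exists n, j. split; auto.
      * auto.
      * intros x Bx H [n Ax]. exact (H n Bx Ax).
  - destruct (IH i) as [j [Hj [C|C]]]; exists j; split; auto; [left|right];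
      apply comeager_on_mono with (1 := C); auto; intros x _; rewrite E; auto.
Qed.

(** * Borel sets and the Vaught transform *)

Lemma borel_forall {T} (op : topology T) (A : nat -> T -> Prop) :
  (forall n, borel op (A n)) -> borel op (fun x => forall n, A n x).
Proof.
  intro H. apply borel_ext with (U := fun x => ~ exists n, ~ A n x).
  - apply borel_compl, borel_cunion. intro n. apply borel_compl, H.
  - intro x. split.
    + intros Hn n. apply NNPP. eauto.
    + intros Ha [n Hn]. auto.
Qed.

Lemma borel_const {T} (op : topology T) (Q : Prop) : is_topology op -> borel op (fun _ => Q).
Proof.
  intros [H1 _]. destruct (classic Q) as [q|q].
  - apply borel_ext with (U := fun _ => True); [apply borel_open; auto | tauto].
  - apply borel_ext with (U := fun _ => ~ True); [apply borel_compl, borel_open; auto | tauto].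
Qed.

Lemma borel_or {T} (op : topology T) (A B : T -> Prop) :
  borel op A -> borel op B -> borel op (fun x => A x \/ B x).
Proof.
  intros HA HB.
  apply borel_ext with (U := fun x => exists n, match n with O => A x | S _ => B x end).
  - apply borel_cunion. intros [|n]; auto.
  - intro x. split; [intros [[|n] H]; auto | intros [H|H]; [exists 0%nat | exists 1%nat]; auto].
Qed.

Lemma borel_and {T} (op : topology T) (A B : T -> Prop) :
  borel op A -> borel op B -> borel op (fun x => A x /\ B x).
Proof.
  intros HA HB. apply borel_ext with (U := fun x => ~ (~ A x \/ ~ B x)).
  - apply borel_compl, borel_or; apply borel_compl; auto.
  - intro x. tauto.
Qed.

Lemma borel_if {T} (op : topology T) (Q : Prop) (A : T -> Prop) :
  is_topology op -> borel op A -> borel op (fun x => Q -> A x).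
Proof.
  intros HT HA. apply borel_ext with (U := fun x => ~ Q \/ A x).
  - apply borel_or; auto. apply borel_const; auto.
  - intro x. destruct (classic Q); tauto.
Qed.

Lemma borel_map_of_open {A B} (oA : topology A) (oB : topology B) (f : A -> B) :
  (forall V, oB V -> borel oA (fun x => V (f x))) -> borel_map oA oB f.
Proof.
  intros H V HV. induction HV as [V HV | V HV IH | V HV IH | V V' HV IH E]; auto.
  - apply borel_compl; auto.
  - apply borel_cunion; auto.
  - apply borel_ext with (1 := IH); auto.
Qed.

(* Borelness of the Vaught transform, for a separately continuous map [p]. *)
Lemma borel_comeager_on {A X Z : Type} (oA : topology A) (oX : topology X) (oZ : topology Z)
  (B : nat -> A -> Prop) (p : A -> X -> Z) (S : Z -> Prop) :
  is_topology oA -> baire oA -> basis oA B -> is_topology oX ->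
  (forall x, continuous oA oZ (fun g => p g x)) -> (forall g, continuous oX oZ (p g)) ->
  borel oZ S -> forall W, oA W ->
  borel oX (fun x => comeager_on oA W (fun g => S (p g x))).
Proof.
  intros HTA HBA HB HTX Hc1 Hc2 HS.
  pose proof HTA as [_ [HT2 _]]. pose proof HB as [HB1 [HB2 HB3]].
  assert (Hloc : forall S' x, borel oZ S' -> forall i, exists j, (forall g, B j g -> B i g) /\
      (comeager_on oA (B j) (fun g => S' (p g x)) \/ comeager_on oA (B j) (fun g => ~ S' (p g x)))).
  { intros S' x HS' i. apply borel_localize; auto.
    apply (borel_map_of_open oA oZ (fun g => p g x)); auto.
    intros V HV. apply borel_open. apply (Hc1 x V HV). }
  assert (Habs : forall i P Q, comeager_on oA (B i) P -> comeager_on oA (B i) Q ->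
      (forall g, P g -> Q g -> False) -> False).
  { intros i P Q HP HQ HPQ. destruct (HB2 i) as [g Bg].
    destruct (comeager_on_meets oA (B i) _ g HBA (HB1 i) Bg (comeager_on_and _ _ _ _ HP HQ))
      as [y [_ [Py Qy]]]. eauto. }
  (* By localization, being meager on [W] is the same as being comeager on no basic set below [W].
     This turns complements into countable intersections. *)
  assert (Hneg : forall S' x W, borel oZ S' -> oA W ->
      (comeager_on oA W (fun g => ~ S' (p g x)) <->
       forall i, (forall g, B i g -> W g) -> ~ comeager_on oA (B i) (fun g => S' (p g x)))).
  { intros S' x W HS' HW. split.
    - intros C i Hi C'. apply (Habs i _ _ C' (comeager_on_mono _ _ _ _ _ C Hi (fun _ _ H => H))); auto.
    - intro H. apply comeager_on_local with (B := B); auto. intros i Hi.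
      destruct (Hloc S' x HS' i) as [j [Hj [C|C]]]; [|eauto].
      exfalso. apply (H j); auto. }
  induction HS as [S HS | S HS IH | S HS IH | S S' HS IH E]; intros W HW.
  (* For open [S], comeager on [W] amounts to dense in [W], that is, to meeting each basic set below
     [W]; each such condition is open in [x]. *)
  - apply borel_ext with (U := fun x => forall i, (forall g, B i g -> W g) ->
                                          exists g, B i g /\ S (p g x)).
    + apply borel_forall. intro i. apply borel_if; auto. apply borel_open.
      apply HTX. intros x [g [Bg Sg]]. exists (fun y => S (p g y)).
      split; [apply (Hc2 g S HS)|]. split; [auto|]. intros y Sy. exists g; auto.
    + intro x. split.
      * intro H. apply comeager_on_local with (B := B); auto. intros i Hi.
        destruct (H i Hi) as [g Hg].
        destruct (HB3 (fun g => B i g /\ S (p g x)) g) as [j [_ Hj]]; auto.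
        { apply HT2; auto. apply (Hc1 x S HS). }
        exists j. split; [apply Hj|]. apply comeager_on_all; auto. apply Hj.
      * intros C i Hi. destruct (HB2 i) as [g Bg].
        apply (comeager_on_meets oA (B i) _ g); auto.
        apply comeager_on_mono with (1 := C); auto.
  - apply borel_ext with (U := fun x => forall i, (forall g, B i g -> W g) ->
                                          ~ comeager_on oA (B i) (fun g => S (p g x))).
    + apply borel_forall. intro i. apply borel_if; auto. apply borel_compl. apply IH; auto.
    + intro x. symmetry. apply Hneg; auto.
  (* A union is comeager on [W] exactly when the basic sets on which a single [S n] is comeager are
     dense below [W]. *)
  - apply borel_ext with (U := fun x => forall i, (forall g, B i g -> W g) ->
        exists n j, (forall g, B j g -> B i g) /\ comeager_on oA (B j) (fun g => S n (p g x))).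
    + apply borel_forall. intro i. apply borel_if; auto.
      apply borel_cunion; intro n. apply borel_cunion; intro j.
      apply borel_and; [apply borel_const; auto | apply IH; auto].
    + intro x. split.
      * intro H. apply comeager_on_local with (B := B); auto. intros i Hi.
        destruct (H i Hi) as [n [j [Hj C]]]. exists j. split; auto.
        apply comeager_on_mono with (1 := C); eauto.
      * intros C i Hi. apply NNPP. intro N.
        assert (C' : forall n, comeager_on oA (B i) (fun g => ~ S n (p g x))).
        { intro n. apply Hneg; auto. intros j Hj Cj. apply N. eauto. }
        apply (comeager_on_forall oA (fun _ => B i)) in C'.
        apply (Habs i _ _ (comeager_on_mono _ _ (B i) _ _ C (fun g => Hi g) (fun _ _ H => H))
                          (comeager_on_mono _ _ (B i) _ (fun g => forall n, ~ S n (p g x)) C'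
                             (fun _ _ => I) (fun g Bg H n => H n Bg))).
        intros g [n Sn] H. exact (H n Sn).
  - apply borel_ext with (1 := IH W HW). intro x.
    split; intro C; apply comeager_on_mono with (1 := C); auto; intros g _; apply E.
Qed.

(** * The Cantor space over a countable index set *)

(** The product topology, with [bool] discrete: a neighbourhood fixes finitely many coordinates. *)
Definition pointwise_open {I : Type} : topology (I -> bool) :=
  fun U => forall p, U p -> exists L : list I,
    forall q, (forall i, In i L -> q i = p i) -> U q.

Lemma exists_least (P : nat -> Prop) :
  (exists n, P n) -> exists n, P n /\ forall m, P m -> (n <= m)%nat.
Proof.
  intros H.
  destruct (Wf_nat.dec_inh_nat_subset_has_unique_least_element P (fun n => classic (P n)) H)
    as [n [Hn _]]. eauto.
Qed.

Lemma exists_testbit (p : nat -> bool) n :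
  exists k, forall m, (m < n)%nat -> Nat.testbit k m = p m.
Proof.
  revert p. induction n; intro p; [exists 0%nat; lia|].
  destruct (IHn (fun m => p (S m))) as [k Hk].
  exists (2 * k + Nat.b2n (p 0%nat))%nat. intros [|m] Hm.
  - apply Nat.testbit_0_r.
  - rewrite Nat.testbit_succ_r. apply Hk. lia.
Qed.

Section Cantor.

Variables (I : Type) (e : nat -> I).
Hypothesis e_surj : forall i, exists n, e n = i.

Let agree n (p q : I -> bool) := forall m, (m < n)%nat -> p (e m) = q (e m).

Lemma cantor_dense_points :
  exists pt : nat -> I -> bool, forall q n, exists k, agree n (pt k) q.
Proof.
  (* The enumeration [e] may repeat indices. Reading the bit at the first occurrence gives a
     well-defined function on [I], and that occurrence stays below [n] whenever some occurrence
     does. *)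
  destruct (choice _ (fun i => exists_least _ (e_surj i))) as [idx Hidx].
  exists (fun k i => Nat.testbit k (idx i)). intros q n.
  destruct (exists_testbit (fun m => q (e m)) n) as [k Hk].
  exists k. intros m Hm. destruct (Hidx (e m)) as [He Hle].
  rewrite Hk, He; auto. specialize (Hle m eq_refl). lia.
Qed.

Lemma pointwise_open_agree (U : (I -> bool) -> Prop) :
  pointwise_open U <-> forall p, U p -> exists n, forall q, agree n p q -> U q.
Proof.
  split; intros H p Up; destruct (H p Up) as [x Hx].
  - assert (HL : exists n, forall q, agree n p q -> forall i, In i x -> q i = p i).
    { clear Hx. induction x as [|i L [n Hn]]; [exists 0%nat; simpl; tauto|].
      destruct (e_surj i) as [m Hm]. exists (S m + n)%nat. intros q Hq j [Hj|Hj].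
      - subst j. rewrite <- Hm. symmetry. apply Hq. lia.
      - apply Hn; auto. intros k Hk. apply Hq. lia. }
    destruct HL as [n Hn]. exists n. intros q Hq. auto.
  - exists (map e (seq 0 x)). intros q Hq. apply Hx. intros m Hm.
    symmetry. apply Hq. apply in_map, in_seq. lia.
Qed.

(** The distance is [/ (INR k + 1)] for the first [k] at which the points differ along [e]. The
    second conjunct describes its balls as cylinders, which is all that later arguments use. *)
Lemma exists_first_difference_metric :
  exists d : (I -> bool) -> (I -> bool) -> R, is_metric d /\
    forall n p q, d p q < / (INR n + 1) <-> agree (S n) p q.
Proof.
  assert (Hd : forall pq : (I -> bool) * (I -> bool), exists r,
    (fst pq = snd pq /\ r = 0) \/
    exists k, r = / (INR k + 1) /\ agree k (fst pq) (snd pq) /\ fst pq (e k) <> snd pq (e k)).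
  { intros [p q]; simpl. destruct (classic (p = q)) as [E|N]; [eauto|].
    destruct (exists_least (fun k => p (e k) <> q (e k))) as [k [Hk Hl]].
    { apply NNPP. intro H. apply N. extensionality i. destruct (e_surj i) as [k <-].
      apply NNPP. eauto. }
    exists (/ (INR k + 1)). right. exists k. repeat split; auto. intros m Hm.
    apply NNPP. intro H. apply Hl in H. lia. }
  destruct (choice _ Hd) as [D HD]. set (d := fun p q => D (p, q)).
  assert (Hspec : forall n p q, d p q < / (INR n + 1) <-> agree (S n) p q).
  { intros n p q. unfold d. destruct (HD (p, q)) as [[E ->]|[k [-> [Hk Hne]]]]; simpl in *.
    - subst q. split; [unfold agree; auto | intros; apply inv_INR_pos].
    - split.
      + intros Hlt m Hm. apply Hk. cut (n < k)%nat; [lia|].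
        apply Nat.nle_gt. intro Hkn. apply le_INR in Hkn. pose proof (pos_INR k).
        assert (/ (INR n + 1) <= / (INR k + 1)) by (apply Rinv_le_contravar; lra). lra.
      + intro H. pose proof (pos_INR n); pose proof (pos_INR k).
        assert (n < k)%nat.
        { apply Nat.nle_gt. intro Hle. apply Hne, H. lia. }
        apply Rinv_lt_contravar; [apply Rmult_lt_0_compat; lra|].
        apply Rplus_lt_compat_r, lt_INR; auto. }
  assert (H0 : forall p q, 0 <= d p q).
  { intros p q. unfold d. destruct (HD (p, q)) as [[_ ->]|[k [-> _]]]; [lra|].
    left. apply inv_INR_pos. }
  assert (Hle : forall p q p' q', (forall n, agree (S n) p q -> agree (S n) p' q') -> d p' q' <= d p q).
  { intros p q p' q' H. apply Rnot_lt_le. intro Hlt. revert Hlt. unfold d at 2.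
    destruct (HD (p', q')) as [[_ ->]|[k [-> [_ Hne]]]]; simpl in *.
    - pose proof (H0 p q). lra.
    - intro Hlt. apply Hspec in Hlt. apply H in Hlt. apply Hne, Hlt. lia. }
  exists d. split; auto. split; [auto | split; [|split]].
  - intros p q. split.
    + intro E. extensionality i. destruct (e_surj i) as [k <-].
      apply (proj1 (Hspec k p q)); [rewrite E; apply inv_INR_pos | lia].
    + intros <-. unfold d. destruct (HD (p, p)) as [[_ ->]|[k [_ [_ H]]]]; simpl in *; tauto.
  - intros p q. apply Rle_antisym; apply Hle; intros n H m Hm; symmetry; auto.
  - intros p q r. apply Rnot_lt_le. intro Hlt.
    pose proof (H0 p q) as Hpq; pose proof (H0 q r) as Hqr.
    revert Hlt. unfold d at 3. destruct (HD (p, r)) as [[_ ->]|[k [-> [_ Hne]]]]; simpl in *;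
      intro Hlt; [lra|].
    (* The ultrametric argument: if the triangle inequality failed, both distances would be below
       [/ (INR k + 1)], so [p] and [r] would agree at [e k]. *)
    assert (H1 : d p q < / (INR k + 1)) by lra. assert (H2 : d q r < / (INR k + 1)) by lra.
    apply Hspec in H1; apply Hspec in H2. apply Hne. rewrite H1, H2; auto.
Qed.

Lemma pointwise_open_polish : polish (@pointwise_open I).
Proof.
  destruct exists_first_difference_metric as [d [Hd Hspec]].
  exists d. split; [split; auto | split].
  - intro U. rewrite pointwise_open_agree. split; intros H p Up; destruct (H p Up) as [x Hx].
    + exists (/ (INR x + 1)). split; [apply inv_INR_pos|]. intros q Hq. apply Hx.
      apply Hspec in Hq. intros m Hm. apply Hq. lia.
    + destruct Hx as [He Hx]. destruct (inv_INR_small x He) as [n Hn].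
      exists (S n). intros q Hq. apply Hx. apply Hspec in Hq. lra.
  - intros s Hs.
    assert (Hag : forall n, exists N, forall k l, (N <= k)%nat -> (N <= l)%nat -> agree (S n) (s k) (s l)).
    { intro n. destruct (Hs (/ (INR n + 1)) (inv_INR_pos n)) as [N HN].
      exists N. intros k l Hk Hl. apply Hspec; auto. }
    (* Along a Cauchy sequence each coordinate is eventually constant, and the limit collects these
       values. *)
    assert (Hlim : forall i, exists b, exists N, forall k, (N <= k)%nat -> s k i = b).
    { intro i. destruct (e_surj i) as [n <-]. destruct (Hag n) as [N HN].
      exists (s N (e n)), N. intros k Hk. apply HN; lia. }
    destruct (choice _ Hlim) as [x Hx]. exists x. intros eps Heps.
    destruct (inv_INR_small eps Heps) as [n Hn]. destruct (Hag n) as [N HN].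
    exists N. intros k Hk. apply Rlt_trans with (2 := Hn). apply Hspec.
    intros m Hm. destruct (Hx (e m)) as [M HM].
    rewrite <- (HM (N + M)%nat) by lia. apply HN; lia.
  - destruct cantor_dense_points as [pt Hpt]. exists pt. intros x eps Heps.
    destruct (inv_INR_small eps Heps) as [n Hn]. destruct (Hpt x (S n)) as [k Hk].
    exists k. apply Rlt_trans with (2 := Hn). apply Hspec.
    intros m Hm. symmetry. auto.
Qed.

(** Every open set is a countable union of cylinders around the dense points, and the preimage of a
    cylinder is a finite intersection of coordinate conditions. *)
Lemma borel_map_pointwise_open {X : Type} (oX : topology X) (phi : X -> I -> bool) :
  is_topology oX -> (forall i, borel oX (fun x => phi x i = true)) ->
  borel_map oX pointwise_open phi.
Proof.
  intros HT Hphi. apply borel_map_of_open. intros V HV.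
  destruct cantor_dense_points as [pt Hpt].
  apply borel_ext with (U := fun x => exists k n,
    (forall q, agree n (pt k) q -> V q) /\ forall m, (m < n)%nat -> pt k (e m) = phi x (e m)).
  - apply borel_cunion; intro k. apply borel_cunion; intro n.
    apply borel_and; [apply borel_const; auto|].
    apply borel_forall; intro m. apply borel_if; auto. destruct (pt k (e m)).
    + apply borel_ext with (1 := Hphi (e m)). split; auto.
    + apply borel_ext with (1 := borel_compl (Hphi (e m))).
      intro x. destruct (phi x (e m)); split; congruence.
  - intro x. split.
    + intros [k [n [HkV Hk]]]. auto.
    + intro Vx. destruct (proj1 (pointwise_open_agree V) HV _ Vx) as [n Hn].
      destruct (Hpt (phi x) n) as [k Hk]. exists k, n. split; auto.
      intros q Hq. apply Hn. intros m Hm. rewrite <- Hk; auto.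
Qed.

End Cantor.

(** * Quotients by open normal subgroups *)

Arguments gmulA {g} x y z.
Arguments gmul1l {g} x.
Arguments gmulVl {g} x.

Lemma gmulVr {G : group} (x : G) : gmul x (ginv x) = gone.
Proof.
  rewrite <- (gmul1l (gmul x (ginv x))).
  rewrite <- (gmulVl (ginv x)) at 1.
  rewrite <- gmulA, (gmulA (ginv x) x), gmulVl, gmul1l. apply gmulVl.
Qed.

Lemma gmul1r {G : group} (x : G) : gmul x gone = x.
Proof. rewrite <- (gmulVl x), gmulA, gmulVr. apply gmul1l. Qed.

Lemma gmulKV {G : group} (x y : G) : gmul x (gmul (ginv x) y) = y.
Proof. rewrite gmulA, gmulVr. apply gmul1l. Qed.

Lemma gmulVK {G : group} (x y : G) : gmul (ginv x) (gmul x y) = y.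
Proof. rewrite gmulA, gmulVl. apply gmul1l. Qed.

Lemma gmulI {G : group} (x y z : G) : gmul x y = gmul x z -> y = z.
Proof. intro H. rewrite <- (gmulVK x y), H. apply gmulVK. Qed.

Lemma ginvM {G : group} (x y : G) : ginv (gmul x y) = gmul (ginv y) (ginv x).
Proof.
  apply (gmulI (gmul x y)). rewrite gmulVr, <- gmulA, gmulKV. symmetry. apply gmulVr.
Qed.

Lemma ginv1 {G : group} : ginv gone = gone :> G.
Proof. rewrite <- (gmul1l (ginv gone)). apply gmulVr. Qed.

Lemma ginvK {G : group} (x : G) : ginv (ginv x) = x.
Proof. apply (gmulI (ginv x)). rewrite gmulVr, gmulVl. auto. Qed.

(** Take the intersection of all conjugates of a small open subgroup [V]. Balls at the identity of a
    two-sided invariant metric are invariant under conjugation, so a ball inside [V] lies in every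
    conjugate and the intersection is open. *)
Lemma open_normal_basis {G : group} (oG : topology G) :
  non_archimedean oG -> has_tsi_metric oG ->
  exists N : nat -> G -> Prop, (forall n, oG (N n) /\ normal_subgroup (N n)) /\
    forall U, oG U -> U gone -> exists n, forall x, N n x -> U x.
Proof.
  intros Hna [d [Hc Hinv]]. pose proof Hc as [[Hp [H0 [Hs Ht]]] Hop].
  assert (HN : forall n, exists N, (oG N /\ normal_subgroup N) /\
    forall x, N x -> d gone x < / (INR n + 1)).
  { intro n. destruct (Hna (fun x => d gone x < / (INR n + 1))) as [V [HV [[V1 [VM Vi]] HVn]]].
    { apply compatible_ball; auto. }
    { rewrite (proj2 (H0 _ _) eq_refl). apply inv_INR_pos. }
    pose proof (proj1 (Hop V) HV gone V1) as [r [Hr HrV]].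
    assert (Hsub : subgroup (fun x => forall g, V (gmul (gmul g x) (ginv g)))).
    { split; [|split].
      - intro g. rewrite gmul1r, gmulVr. auto.
      - intros x y Hx Hy g. specialize (VM _ _ (Hx g) (Hy g)).
        rewrite <- !gmulA, gmulVK, !gmulA in VM. rewrite !gmulA. auto.
      - intros x Hx g. specialize (Vi _ (Hx g)).
        rewrite !ginvM, ginvK, gmulA in Vi. auto. }
    exists (fun x => forall g, V (gmul (gmul g x) (ginv g))). split; [split|].
    (* Write [y] as [x] times [ginv x * y]; the second factor is at distance [d x y < r] from the
       identity, hence so are all its conjugates. *)
    - apply Hop. intros x Hx. exists r. split; auto. intros y Hy.
      rewrite <- (gmulKV x y). apply Hsub; auto. intro g. apply HrV.
      rewrite <- (gmulVr g) at 1. rewrite (proj2 (Hinv (ginv g) g _)).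
      rewrite <- (gmul1r g) at 1. rewrite (proj1 (Hinv g gone _)).
      rewrite <- (gmulVl x). rewrite (proj1 (Hinv (ginv x) x y)). auto.
    - split; auto. intros g h Hh k. specialize (Hh (gmul k g)).
      rewrite ginvM in Hh. rewrite !gmulA in *. auto.
    - intros x Hx. apply HVn. specialize (Hx gone).
      rewrite ginv1, gmul1l, gmul1r in Hx. auto. }
  destruct (choice _ HN) as [N HN']. exists N. split; [apply HN'|].
  intros U HU U1. destruct (proj1 (Hop U) HU gone U1) as [r [Hr HrU]].
  destruct (inv_INR_small r Hr) as [n Hn]. exists n. intros x Nx. apply HrU.
  apply Rlt_trans with (2 := Hn). apply HN'. auto.
Qed.

Section Quotient.

Variables (G : group) (N : G -> Prop).
Hypothesis N_normal : normal_subgroup N.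

(** The predicate given to [epsilon] depends only on the coset of [g], so by extensionality the
    chosen representative does too. The quotient can then be the subtype of fixed points of
    [coset_rep]. *)
Definition coset_rep (g : G) : G := epsilon (inhabits gone) (fun h => N (gmul (ginv g) h)).

Lemma coset_rep_spec g : N (gmul (ginv g) (coset_rep g)).
Proof.
  unfold coset_rep. apply epsilon_spec. exists g. rewrite gmulVl. apply N_normal.
Qed.

Lemma coset_rep_eq g h : coset_rep g = coset_rep h <-> N (gmul (ginv g) h).
Proof.
  destruct N_normal as [[N1 [NM NV]] _]. split.
  - intro E. pose proof (coset_rep_spec g) as Hg; pose proof (coset_rep_spec h) as Hh.
    rewrite E in Hg. apply NV in Hh. rewrite ginvM, ginvK in Hh.
    pose proof (NM _ _ Hg Hh) as H. rewrite <- gmulA, gmulKV in H. auto.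
  - intro H. unfold coset_rep. f_equal. extensionality k. apply propositional_extensionality.
    split; intro K.
    + apply NV in H. rewrite ginvM, ginvK in H.
      pose proof (NM _ _ H K) as M. rewrite <- gmulA, gmulKV in M. auto.
    + pose proof (NM _ _ H K) as M. rewrite <- gmulA, gmulKV in M. auto.
Qed.

Lemma coset_rep_idem g : coset_rep (coset_rep g) = coset_rep g.
Proof. symmetry. apply coset_rep_eq, coset_rep_spec. Qed.

Definition quotient_proj (g : G) : {g | coset_rep g = g} :=
  exist _ (coset_rep g) (coset_rep_idem g).

Lemma quotient_proj_eq g h : quotient_proj g = quotient_proj h <-> N (gmul (ginv g) h).
Proof.
  rewrite <- coset_rep_eq. split.
  - intro E. exact (f_equal (@proj1_sig _ _) E).
  - intro E. apply eq_sig_hprop; auto. intros. apply proof_irrelevance.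
Qed.

Lemma quotient_proj_val (u : {g | coset_rep g = g}) : quotient_proj (proj1_sig u) = u.
Proof. apply eq_sig_hprop; [intros; apply proof_irrelevance | exact (proj2_sig u)]. Qed.

Lemma quotient_proj_surj (u : {g | coset_rep g = g}) : exists g, quotient_proj g = u.
Proof. exists (proj1_sig u). apply quotient_proj_val. Qed.

Definition quotient_mul (u v : {g | coset_rep g = g}) :=
  quotient_proj (gmul (proj1_sig u) (proj1_sig v)).

Definition quotient_inv (u : {g | coset_rep g = g}) := quotient_proj (ginv (proj1_sig u)).

Lemma quotient_proj_mul g h :
  quotient_proj (gmul g h) = quotient_mul (quotient_proj g) (quotient_proj h).
Proof.
  destruct N_normal as [[N1 [NM NV]] NC]. apply quotient_proj_eq. simpl.
  (* Normality enters here: the error [ginv g * coset_rep g] has to be conjugated past [h]. *)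
  pose proof (NC (ginv h) _ (coset_rep_spec g)) as Hg. rewrite ginvK in Hg.
  pose proof (NM _ _ Hg (coset_rep_spec h)) as H.
  rewrite <- !gmulA, gmulKV, gmulA in H. rewrite ginvM, <- !gmulA. rewrite <- !gmulA in H. auto.
Qed.

Lemma quotient_mulA u v w : quotient_mul u (quotient_mul v w) = quotient_mul (quotient_mul u v) w.
Proof.
  destruct (quotient_proj_surj u) as [x <-], (quotient_proj_surj v) as [y <-],
    (quotient_proj_surj w) as [z <-].
  rewrite <- !quotient_proj_mul, gmulA. auto.
Qed.

Lemma quotient_mul1l u : quotient_mul (quotient_proj gone) u = u.
Proof.
  destruct (quotient_proj_surj u) as [x <-]. rewrite <- quotient_proj_mul, gmul1l. auto.
Qed.

Lemma quotient_mulVl u : quotient_mul (quotient_inv u) u = quotient_proj gone.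
Proof.
  rewrite <- (quotient_proj_val u) at 2. unfold quotient_inv.
  rewrite <- quotient_proj_mul, gmulVl. auto.
Qed.

Definition quotient_group : group :=
  @Group {g | coset_rep g = g} quotient_mul quotient_inv (quotient_proj gone)
    quotient_mulA quotient_mul1l quotient_mulVl.

Lemma quotient_proj_quotient_map : @quotient_map G quotient_group N quotient_proj.
Proof.
  split; [exact quotient_proj_mul | split; [exact quotient_proj_surj|]].
  intro g. change (quotient_proj g = quotient_proj gone <-> N g).
  transitivity (N (gmul (ginv gone) g)).
  - rewrite <- quotient_proj_eq. split; auto.
  - rewrite ginv1, gmul1l. tauto.
Qed.

End Quotient.

(** * Coset profiles *)

Lemma continuous_prod_l {A B C} (oA : topology A) (oB : topology B) (oC : topology C) F b :
  is_topology oA -> continuous (prod_open oA oB) oC F -> continuous oA oC (fun x => F (x, b)).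
Proof.
  intros HT HF S HS. apply HT. intros x Sx.
  destruct (HF S HS (x, b) Sx) as [V [W [HV [HW [Vx [Wb H]]]]]]. exists V; auto.
Qed.

Lemma continuous_prod_r {A B C} (oA : topology A) (oB : topology B) (oC : topology C) F b :
  is_topology oA -> continuous (prod_open oB oA) oC F -> continuous oA oC (fun x => F (b, x)).
Proof.
  intros HT HF S HS. apply HT. intros x Sx.
  destruct (HF S HS (b, x) Sx) as [V [W [HV [HW [Vx [Wb H]]]]]]. exists W; auto.
Qed.

Lemma polish_is_topology {T} (op : topology T) : polish op -> is_topology op.
Proof. intros [d [Hc _]]. apply (compatible_topology op d Hc). Qed.

Lemma polish_separating_family {T} (op : topology T) :
  polish op -> exists V : nat -> T -> Prop, (forall k, op (V k)) /\
    forall x y, (forall k, V k x <-> V k y) -> x = y.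
Proof.
  intro HP. destruct (polish_basis op HP) as [B [HB1 [_ HB3]]].
  destruct HP as [d [Hc _]]. pose proof Hc as [[Hp [H0 _]] _].
  exists B. split; auto. intros x y Hxy. apply H0. apply NNPP. intro N.
  assert (Hd : 0 < d x y) by (destruct (Hp x y); auto; congruence).
  destruct (HB3 (fun z => d x z < d x y) x) as [i [Bx Hi]].
  - apply compatible_ball; auto.
  - rewrite (proj2 (H0 x x) eq_refl); auto.
  - apply Hxy, Hi in Bx. lra.
Qed.

Lemma comeager_on_translate {G : group} (oG : topology G) (W P : G -> Prop) g :
  is_topology oG -> continuous (prod_open oG oG) oG (fun p => gmul (fst p) (snd p)) ->
  comeager_on oG W P -> comeager_on oG (fun h => W (gmul h g)) (fun h => P (gmul h g)).
Proof.
  intros HT Hm [O [HO [HD H]]].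
  assert (Hc : forall k, continuous oG oG (fun h => gmul h k)).
  { intro k. apply (continuous_prod_l oG oG oG _ k HT Hm). }
  exists (fun i h => O i (gmul h g)). split; [|split].
  - intro i. apply (Hc g (O i)); auto.
  - intros i U x HU Ux.
    destruct (HD i (fun y => U (gmul y (ginv g))) (gmul x g)) as [y [Uy Oy]].
    + apply (Hc (ginv g) U); auto.
    + rewrite <- gmulA, gmulVr, gmul1r. auto.
    + exists (gmul y (ginv g)). rewrite <- (gmulA y), gmulVl, gmul1r. auto.
  - intros h Wh Hh. apply H; auto.
Qed.

(** Both signs are recorded because neither a set nor its complement need be comeager on a given
    coset. *)
Definition signed {Y} (V : nat -> Y -> Prop) (j : nat * bool) (y : Y) : Prop :=
  if snd j then V (fst j) y else ~ V (fst j) y.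

Definition coset_profile {G H : group} {X Y : Type} (oG : topology G) (a : G -> X -> X)
  (f : X -> Y) (V : nat -> Y -> Prop) (pi : G -> H) (x : X) (i : H * (nat * bool)) : bool :=
  if excluded_middle_informative
       (comeager_on oG (fun g => pi g = fst i) (fun g => signed V (snd i) (f (a g x))))
  then true else false.

(* On a coset [c] that is determined at [x], the map [g => f (a g x)] is
   constant on a comeager set. *)
Definition determined {H : group} (phi : H * (nat * bool) -> bool) (c : H) : Prop :=
  forall k, exists b, phi (c, (k, b)) = true.

(** Right multiplication of the argument yields a left action, since the functions are composed with
    it. *)
Definition shift {H I : Type} (mul : H -> H -> H) (h : H) (phi : H * I -> bool) : H * I -> bool :=
  fun i => phi (mul (fst i) h, snd i).

Lemma shift_discrete_continuous_action (H : group) (I : Type) :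
  discrete_continuous_action (@pointwise_open (H * I)) (shift (@gmul H)).
Proof.
  split; [split|].
  - intro phi. extensionality i. destruct i as [c j]. unfold shift; simpl. rewrite gmul1r. auto.
  - intros g h phi. extensionality i. unfold shift; simpl. rewrite gmulA. auto.
  - intros h U HU phi Uphi. destruct (HU _ Uphi) as [L HL].
    exists (map (fun i => (gmul (fst i) h, snd i)) L). intros q Hq. apply HL.
    intros i Hi. apply (Hq (gmul (fst i) h, snd i)).
    apply (in_map (fun i => (gmul (fst i) h, snd i))). auto.
Qed.

Section Profile.

Variables (G : group) (oG : topology G) (X : Type) (oX : topology X) (a : G -> X -> X).
Variables (Y : Type) (oY : topology Y) (f : X -> Y) (V : nat -> Y -> Prop).
Variables (N : G -> Prop) (H : group) (pi : G -> H).

Hypothesis G_polish : polish_group oG.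
Hypothesis X_polish : polish oX.
Hypothesis a_cont : continuous_action oG oX a.
Hypothesis f_borel : borel_map oX oY f.
Hypothesis V_open : forall k, oY (V k).
Hypothesis V_sep : forall y z, (forall k, V k y <-> V k z) -> y = z.
Hypothesis N_open : oG N.
Hypothesis pi_quotient : quotient_map N pi.

Let profile := coset_profile oG a f V pi.

Let G_topology : is_topology oG.
Proof. apply polish_is_topology, G_polish. Qed.

Let X_topology : is_topology oX.
Proof. apply polish_is_topology, X_polish. Qed.

Lemma orbit_continuous x : continuous oG oX (fun g => a g x).
Proof. apply (continuous_prod_l oG oX oX _ x G_topology (proj2 a_cont)). Qed.

Lemma act_continuous g : continuous oX oX (a g).
Proof. apply (continuous_prod_r oX oG oX _ g X_topology (proj2 a_cont)). Qed.

Lemma quotient_map_inv g : pi (ginv g) = ginv (pi g).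
Proof.
  destruct pi_quotient as [Hm _].
  apply (gmulI (pi g)). rewrite <- Hm, !gmulVr. apply (gmulI (pi gone)).
  rewrite <- Hm, gmul1l, gmul1r. auto.
Qed.

Lemma quotient_map_fiber g h : pi h = pi g <-> N (gmul (ginv g) h).
Proof.
  destruct pi_quotient as [Hm [_ Hk]]. rewrite <- Hk, Hm, quotient_map_inv.
  split; intro K; [rewrite K; apply gmulVl|].
  rewrite <- (gmul1r (pi g)), <- K. symmetry. apply gmulKV.
Qed.

Lemma coset_open c : oG (fun g => pi g = c).
Proof.
  destruct (proj1 (proj2 pi_quotient) c) as [g <-].
  apply G_topology. intros h Hh. exists (fun k => N (gmul (ginv g) k)).
  split; [|split].
  - apply (continuous_prod_r oG oG oG _ (ginv g) G_topology (proj1 (proj2 G_polish)) N N_open).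
  - apply quotient_map_fiber; auto.
  - intros k. apply quotient_map_fiber.
Qed.

(** Each coset is open and nonempty, hence contains a basic set; one point from each basic set
    therefore meets every coset. *)
Lemma quotient_countable : exists e : nat -> H, forall h, exists n, e n = h.
Proof.
  destruct (polish_basis oG (proj1 G_polish)) as [B [_ [HB2 HB3]]].
  destruct (choice _ HB2) as [s Hs]. exists (fun n => pi (s n)). intro h.
  destruct (proj1 (proj2 pi_quotient) h) as [g Hg].
  destruct (HB3 _ g (coset_open h) Hg) as [i [_ Hi]]. exists i. apply Hi, Hs.
Qed.

Lemma profile_spec x c j : profile x (c, j) = true <->
  comeager_on oG (fun g => pi g = c) (fun g => signed V j (f (a g x))).
Proof.
  unfold profile, coset_profile; simpl.
  destruct excluded_middle_informative; split; auto; discriminate.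
Qed.

(** Since [a h (a g x)] is [a (gmul h g) x], the profile of [a g x] on a coset is that of [x] on its
    right translate by [g], and right translation preserves comeagerness. *)
Lemma profile_act g x : profile (a g x) = shift (@gmul H) (pi g) (profile x).
Proof.
  extensionality i. destruct i as [c j]. unfold shift; simpl.
  pose proof (proj1 pi_quotient) as Hm.
  apply Bool.eq_iff_eq_true. rewrite !profile_spec. split; intro C.
  - apply (comeager_on_translate oG _ _ (ginv g) G_topology (proj1 (proj2 G_polish))) in C.
    apply comeager_on_mono with (1 := C).
    + intros h Hh. rewrite Hm, Hh, quotient_map_inv, <- gmulA, gmulVr. apply gmul1r.
    + intros h _. rewrite <- (proj2 (proj1 a_cont)), <- gmulA, gmulVl, gmul1r. auto.
  - apply (comeager_on_translate oG _ _ g G_topology (proj1 (proj2 G_polish))) in C.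
    apply comeager_on_mono with (1 := C).
    + intros h Hh. rewrite Hm, Hh. auto.
    + intros h _. rewrite (proj2 (proj1 a_cont)). auto.
Qed.

Lemma profile_borel i : borel oX (fun x => profile x i = true).
Proof.
  destruct i as [c j].
  destruct (polish_basis oG (proj1 G_polish)) as [B HB].
  apply borel_ext with (U := fun x => comeager_on oG (fun g => pi g = c)
                                        (fun g => signed V j (f (a g x)))).
  - apply (borel_comeager_on oG oX oX B a (fun x => signed V j (f x))); auto.
    + apply polish_baire, G_polish.
    + apply orbit_continuous.
    + apply act_continuous.
    + apply (f_borel (signed V j)). unfold signed. destruct (snd j).
      * apply borel_open; auto.
      * apply borel_compl, borel_open; auto.
    + apply coset_open.
  - intro x. symmetry. apply profile_spec.
Qed.

Lemma determined_shift h phi : (exists c : H, determined phi c) ->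
  exists c : H, determined (shift (@gmul H) h phi) c.
Proof.
  intros [c Hc]. exists (gmul c (ginv h)). intro k. destruct (Hc k) as [b Hb].
  exists b. unfold shift; simpl. rewrite <- gmulA, gmulVl, gmul1r. auto.
Qed.

(** For each [k] a common sign holds generically on [c] for both [x] and [y]. Intersecting over [k]
    and applying Baire category gives one [g] at which no [V k] separates the two values. *)
Lemma profile_separates x y c :
  determined (profile x) c -> profile x = profile y -> exists g, f (a g x) = f (a g y).
Proof.
  intros Hc E. destruct (proj1 (proj2 pi_quotient) c) as [g Hg].
  assert (C : comeager_on oG (fun g => pi g = c)
                (fun g => forall k, V k (f (a g x)) <-> V k (f (a g y)))).
  { apply comeager_on_mono with (W := fun _ => True)
      (P := fun g => forall k, pi g = c -> (V k (f (a g x)) <-> V k (f (a g y)))); auto.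
    apply (comeager_on_forall oG (fun _ g => pi g = c)). intro k.
    destruct (Hc k) as [b Hb]. pose proof Hb as Hb'. rewrite E in Hb'.
    apply profile_spec in Hb; apply profile_spec in Hb'.
    apply comeager_on_mono with (1 := comeager_on_and _ _ _ _ Hb Hb'); auto.
    intros h _ [H1 H2]. unfold signed in *. destruct b; simpl in *; tauto. }
  destruct (comeager_on_meets oG _ _ g (polish_baire oG (proj1 G_polish)) (coset_open c) Hg C)
    as [h [_ Hh]].
  exists h. auto.
Qed.

End Profile.

(* Countably many values cover all of [G], so by Baire category one of them is
   taken on a comeager subset of some basic open set. *)
Lemma comeager_fiber {A Y : Type} (oA : topology A) (oY : topology Y) (B : nat -> A -> Prop)
  (V : nat -> Y -> Prop) (F : A -> Y) (s : nat -> Y) (a0 : A) :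
  is_topology oA -> baire oA -> basis oA B ->
  (forall k, oY (V k)) -> (forall y z, (forall k, V k y <-> V k z) -> y = z) ->
  borel_map oA oY F -> (forall g, exists i, s i = F g) ->
  exists i j, comeager_on oA (B j) (fun g => s i = F g).
Proof.
  intros HT HBa HB HV Hsep HF Hs. apply NNPP. intro Hno.
  assert (HP : forall i, borel oA (fun g => s i = F g)).
  { intro i. apply (HF (fun y => s i = y)).
    (* A singleton is Borel: the separating family writes it as a countable intersection of sets
       [V k] and complements. *)
    apply borel_ext with (U := fun y => forall k, if excluded_middle_informative (V k (s i))
                                                  then V k y else ~ V k y).
    - apply borel_forall. intro k. destruct excluded_middle_informative.
      + apply borel_open; auto.
      + apply borel_compl, borel_open; auto.
    - intro y. split.
      + intro H. apply Hsep. intro k. specialize (H k).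
        destruct excluded_middle_informative; tauto.
      + intros <- k. destruct excluded_middle_informative; auto. }
  assert (C : comeager_on oA (fun _ => True) (fun g => forall i : nat, True -> s i <> F g)).
  { apply (comeager_on_forall oA (fun _ _ => True)). intro i.
    apply (comeager_on_local oA B); auto; [exact (proj1 HT)|]. intros j _.
    destruct (borel_localize oA B _ HT HB (HP i) j) as [k [Hk [C|C]]]; [|eauto].
    exfalso. eauto. }
  destruct (comeager_on_meets oA _ _ a0 HBa (proj1 HT) I C) as [g [_ Hg]].
  destruct (Hs g) as [i Hi]. exact (Hg i I Hi).
Qed.

Theorem theorem2 (G : group) (oG : topology G) (X : Type) (oX : topology X)
  (a : G -> X -> X) :
  polish_group oG -> non_archimedean oG -> has_tsi_metric oG ->
  polish oX -> continuous_action oG oX a ->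
  essentially_countable oX (orbit_rel a) ->
  exists (N : nat -> G -> Prop) (H : nat -> group) (pi : forall n, G -> H n)
         (Xn : nat -> Type) (oXn : forall n, topology (Xn n))
         (b : forall n, H n -> Xn n -> Xn n),
    (forall n, oG (N n) /\ normal_subgroup (N n) /\ quotient_map (N n) (pi n) /\
               polish (oXn n) /\ discrete_continuous_action (oXn n) (b n)) /\
    borel_reducible oX (sum_open oXn) (orbit_rel a)
      (sum_rel (fun n => orbit_rel (b n))).
Proof.
  intros HG Hna Htsi HX Ha [Y [oY [F [HY [[_ [Fsym Ftrans]] [_ [Fcount [[f [Hf Hred]] _]]]]]]]].
  destruct (open_normal_basis oG Hna Htsi) as [N [HN HNbasis]].
  destruct (polish_separating_family oY HY) as [V [HV Hsep]].
  pose proof (polish_is_topology oG (proj1 HG)) as HTG.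
  pose proof (polish_is_topology oX HX) as HTX.
  set (H := fun n => quotient_group G (N n) (proj2 (HN n))).
  set (pi := fun n => quotient_proj G (N n) (proj2 (HN n)) : G -> H n).
  assert (Hpi : forall n, quotient_map (N n) (pi n)).
  { intro n. apply quotient_proj_quotient_map. }
  assert (Henum : forall n, exists e : nat -> H n * (nat * bool), forall i, exists k, e k = i).
  { intro n. destruct (quotient_countable G oG (N n) (H n) (pi n)) as [e He]; auto.
    { apply HN. }
    exists (fun k => let (u, v) := of_nat k in let (k', r) := of_nat v in
                     (e u, (k', Nat.eqb r 0))).
    intros [h [k b]]. destruct (He h) as [u <-].
    exists (to_nat (u, to_nat (k, if b then 0%nat else 1%nat))).
    rewrite !cancel_of_to. destruct b; auto. }
  set (phi := fun n => coset_profile oG a f V (pi n)).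
  set (good := fun n x => exists c : H n, determined (phi n x) c).
  assert (Hact : forall n g x, phi n (a g x) = shift (@gmul (H n)) (pi n g) (phi n x)).
  { intros n g x. apply (profile_act G oG X oX a Y f V (N n)); auto. }
  assert (Hgood_act : forall n g x, good n x -> good n (a g x)).
  { intros n g x Hx. unfold good. rewrite Hact. apply determined_shift; auto. }
  assert (Hex : forall x, exists n, good n x).
  { intro x. destruct (polish_basis oG (proj1 HG)) as [B HB].
    destruct (Fcount (f x)) as [s Hs].
    destruct (comeager_fiber oG oY B V (fun g => f (a g x)) s gone) as [i [j C]]; auto.
    - apply polish_baire, HG.
    - intros S HS.
      apply (borel_map_of_open oG oX (fun g => a g x)) with (V := fun z => S (f z)); auto.
      intros U HU. apply borel_open. apply (orbit_continuous G oG X oX a HG Ha x U HU).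
    - intro g. apply Hs, Hred. exists g. auto.
    - destruct HB as [HB1 [HB2 _]]. destruct (HB2 j) as [g Bg].
      (* Choose [N n] so small that the coset of [g] lies in [B j], where the value [s i] is
         generic. *)
      destruct (HNbasis (fun h => B j (gmul g h))) as [n Hn].
      + apply (continuous_prod_r oG oG oG _ g HTG (proj1 (proj2 HG))); auto.
      + rewrite gmul1r. auto.
      + exists n, (pi n g). intro k.
        (* The sign is dictated by the generic value [s i]. *)
        exists (if excluded_middle_informative (V k (s i)) then true else false).
        apply (profile_spec G oG X a Y f V).
        apply comeager_on_mono with (1 := C).
        * intros h Hh. apply (quotient_map_fiber G (N n) (H n) (pi n) (Hpi n)) in Hh.
          apply Hn in Hh. rewrite gmulKV in Hh. auto.
        * intros h _ <-. unfold signed; simpl. destruct excluded_middle_informative; auto. }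
  (* Goodness at a level is invariant along orbits, so the least good level [nx] is constant on each
     orbit. *)
  destruct (choice _ (fun x => exists_least _ (Hex x))) as [nx Hnx].
  exists N, H, pi, (fun n => H n * (nat * bool) -> bool), (fun n => pointwise_open),
    (fun n => shift (@gmul (H n))).
  split.
  - intro n. split; [apply HN|]. split; [apply HN|]. split; [apply Hpi|]. split.
    + destruct (Henum n) as [e He]. apply (pointwise_open_polish _ e He).
    + apply shift_discrete_continuous_action.
  - exists (fun x => existT _ (nx x) (phi (nx x) x)). split.
    + apply borel_map_of_open. intros U HU.
      assert (Hgood : forall n, borel oX (good n)).
      { intro n. destruct (Henum n) as [e He].
        apply borel_ext with (U := fun x => exists m, forall k,
          phi n x (fst (e m), (k, true)) = true \/ phi n x (fst (e m), (k, false)) = true).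
        - apply borel_cunion; intro m. apply borel_forall; intro k.
          apply borel_or; apply (profile_borel G oG X oX a Y oY f V (N n)); auto; apply HN.
        - intro x. split.
          + intros [m Hm]. exists (fst (e m)). intro k. destruct (Hm k); eauto.
          + intros [c Hc]. destruct (He (c, (0%nat, true))) as [m Hm]. exists m.
            rewrite Hm; simpl. intro k. destruct (Hc k) as [[|] Hb]; auto. }
      (* Split [X] into the countably many Borel pieces on which the least good level is [n]. *)
      apply borel_ext with (U := fun x => exists n,
        (good n x /\ forall m, (m < n)%nat -> ~ good m x) /\ U (existT _ n (phi n x))).
      * apply borel_cunion; intro n. apply borel_and; [apply borel_and; auto|].
        -- apply borel_forall; intro m. apply borel_if; auto. apply borel_compl; auto.
        -- destruct (Henum n) as [e He].
           apply (borel_map_pointwise_open _ e He oX (phi n) HTX) with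
             (V := fun p => U (existT _ n p)).
           ++ intro i. apply (profile_borel G oG X oX a Y oY f V (N n)); auto; apply HN.
           ++ apply borel_open, HU.
      * intro x. destruct (Hnx x) as [Hg Hl]. split.
        -- intros [n [[Hn Hmin] Un]]. replace (nx x) with n; auto.
           apply Nat.le_antisymm; [|apply Hl; auto].
           apply Nat.nlt_ge. intro Hlt. exact (Hmin _ Hlt Hg).
        -- intro Ux. exists (nx x). split; auto. split; auto. intros m Hm Hgm.
           apply Hl in Hgm. lia.
    + intros x y. split.
      * intros [g <-]. exists (nx x), (phi (nx x) x), (phi (nx x) (a g x)).
        split; auto. split.
        -- replace (nx (a g x)) with (nx x); auto.
           destruct (Hnx x) as [Hx Hlx], (Hnx (a g x)) as [Hy Hly].
           apply Nat.le_antisymm; [apply Hlx | apply Hly; auto].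
           apply (Hgood_act _ (ginv g)) in Hy.
           rewrite <- (proj2 (proj1 Ha)), gmulVl, (proj1 (proj1 Ha)) in Hy. auto.
        -- exists (pi (nx x) g). symmetry. apply Hact.
      * intros [n [p [q [Ep [Eq [h Hh]]]]]].
        destruct (Hnx x) as [[c Hc] _], (Hnx y) as [[c' Hc'] _].
        pose proof (f_equal (@projT1 _ _) Ep) as En; simpl in En.
        pose proof (f_equal (@projT1 _ _) Eq) as En'; simpl in En'.
        (* The types of [c] and [c'] depend on the levels, so these are generalized before both
           levels are identified with [n]. *)
        revert Ep Eq c Hc c' Hc'. rewrite En, En'. intros Ep Eq c Hc c' Hc'.
        apply inj_pair2_eq_dec in Ep; [|decide equality].
        apply inj_pair2_eq_dec in Eq; [|decide equality]. rewrite <- Ep, <- Eq in Hh.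
        (* Lift [h] to [g] in [G]. Equivariance makes the profiles of [y] and [a g x] equal, so [f]
           takes a common value on their orbits. *)
        destruct (proj1 (proj2 (Hpi n)) h) as [g <-].
        rewrite <- Hact in Hh. symmetry in Hh.
        destruct (profile_separates G oG X a Y f V (N n) (H n) (pi n) HG Hsep
                    (proj1 (HN n)) (Hpi n) _ _ _ Hc' Hh) as [k Hk].
        apply Hred. apply Ftrans with (f (a k y)).
        -- rewrite Hk. apply Hred. exists (gmul k g). apply Ha.
        -- apply Fsym, Hred. exists k. auto.
Qed.
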